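(* Let $\mathcal{O}$ be a Dedekind domain with field of fractions $K$, $\mathcal{O}\neq K$, let $\Lambda$ be an $\mathcal{O}$-order in a separable $K$-algebra $A$, and let $\mathcal{M}$ be a maximal $\mathcal{O}$-order in $A$ with $\Lambda\subseteq\mathcal{M}$. Let $X$ and $Y$ be locally isomorphic $\Lambda$-lattices such that there exists an isomorphism of $\mathcal{M}$-lattices $f\colon\mathcal{M}X\to\mathcal{M}Y$. Then $f$ restricts to an isomorphism of $\Lambda$-lattices $f|_X\colon X\to Y$ if and only if $f(X)\subseteq Y$.
   Context: A separable $K$-algebra is a finite-dimensional semisimple $K$-algebra such that the center of each simple component is separable over $K$. An $\mathcal{O}$-order in $A$ is a subring of $A$ (same unity) that is a finitely generated $\mathcal{O}$-submodule spanning $A$ over $K$; it is maximal if it is not properly contained in another $\mathcal{O}$-order. A $\Lambda$-lattice is a left $\Lambda$-module finitely generated and torsion-free over $\mathcal{O}$, viewed inside the $A$-module $KX=K\otimes_{\mathcal{O}}X$; $\mathcal{M}X$ denotes the $\mathcal{M}$-submodule of $KX$ generated by $X$. For a maximal ideal $\mathfrak{p}$ of $\mathcal{O}$, $\mathcal{O}_{\mathfrak{p}}$ is the localization (not completion), $X_{\mathfrak{p}}=\mathcal{O}_{\mathfrak{p}}X$ and $\Lambda_{\mathfrak{p}}=\mathcal{O}_{\mathfrak{p}}\Lambda$. Two $\Lambda$-lattices $X,Y$ are locally isomorphic if $X_{\mathfrak{p}}\cong Y_{\mathfrak{p}}$ as $\Lambda_{\mathfrak{p}}$-modules for every maximal ideal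 $\mathfrak{p}$ of $\mathcal{O}$. *)

(* Defs.v *)
From HB Require Import structures.
From mathcomp Require Import all_boot all_algebra all_field.
From mathcomp Require Import boolp classical_sets functions cardinality.

Set Implicit Arguments.
Unset Strict Implicit.
Unset Printing Implicit Defensive.

Import GRing.Theory.
Local Open Scope classical_set_scope.
Local Open Scope ring_scope.

(* Rings such as O, O_p, K, Lambda and M all act through subsets S of one
   ambient ring R, so that submodules, generation and isomorphisms over each
   of them are instances of the same four notions. *)
Section SubringModules.
Variable R : pzRingType.

Definition submodule (V : lmodType R) (S : set R) (X : set V) : Prop :=
  [/\ X 0,
      forall x y, X x -> X y -> X (x - y) &
      forall s x, S s -> X x -> X (s *: x)].

(* The product S X: all finite sums of elements s *: x. *)
Definition sprod (V : lmodType R) (S : set R) (X : set V) : set V :=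
  [set v | exists (n : nat) (s : 'I_n -> R) (x : 'I_n -> V),
     [/\ forall i, S (s i), forall i, X (x i) & v = \sum_i s i *: x i]].

Definition fin_gen (V : lmodType R) (S : set R) (X : set V) : Prop :=
  exists2 G : set V, finite_set G & X = sprod S G.

(* Only the restriction of f to X matters; f is arbitrary elsewhere. *)
Definition smod_iso (V W : lmodType R) (S : set R) (X : set V) (Y : set W)
    (f : V -> W) : Prop :=
  [/\ set_bij X Y f,
      forall x y, X x -> X y -> f (x + y) = f x + f y &
      forall s x, S s -> X x -> f (s *: x) = s *: f x].

End SubringModules.

Section Dedekind.
Variable O : idomainType.

Definition is_ideal (I : set O) : Prop := submodule setT (I : set O^o).

Definition is_prime_ideal (P : set O) : Prop :=
  [/\ is_ideal P, ~ P 1 & forall x y, P (x * y) -> P x \/ P y].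

Definition is_maximal_ideal (P : set O) : Prop :=
  [/\ is_ideal P, ~ P 1 &
      forall I, is_ideal I -> ~ I 1 -> P `<=` I -> I = P].

(* Fields are not excluded here. *)
Definition dedekind_domain : Prop :=
  [/\ forall I, is_ideal I -> fin_gen setT (I : set O^o),
      forall u : {fraction O}, integralOver (@tofrac O) u ->
        exists a : O, u = tofrac a &
      forall P, is_prime_ideal P -> P != [set 0] -> is_maximal_ideal P].

Definition is_fraction_field (K : fieldType) (iota : {rmorphism O -> K}) :=
  injective iota /\
  forall k, exists a b : O, b != 0 /\ k = iota a / iota b.

End Dedekind.

Section SeparableAlgebra.
Variables (K : fieldType) (A : falgType K).

(* Every one- or two-sided ideal of A is a K-subspace, hence given by a
   {vspace A}. *)
Definition left_idealv (U : {vspace A}) : Prop := ({:A} * U <= U)%VS.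

Definition two_sided_idealv (U : {vspace A}) : Prop :=
  left_idealv U /\ (U * {:A} <= U)%VS.

Definition semisimple_algebra : Prop :=
  forall U, left_idealv U ->
    exists V, [/\ left_idealv V, (U + V)%VS = fullv & (U :&: V)%VS = 0%VS].

(* The simple components of a semisimple algebra are its minimal nonzero
   two-sided ideals. *)
Definition simple_component (B : {vspace A}) : Prop :=
  [/\ two_sided_idealv B, B != 0%VS &
      forall U, two_sided_idealv U -> U != 0%VS -> (U <= B)%VS -> U = B].

(* The identity of Z is in general not 1 : A, so Z is compared with an abstract
   extension L through a multiplicative K-linear bijection that need not send
   1 to 1. *)
Definition separable_subfield (Z : {vspace A}) : Prop :=
  exists (L : fieldExtType K) (phi : 'Hom(L, A)),
    [/\ injective phi, {morph phi : x y / x * y}, limg phi = Z &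
        separable 1 {:L}].

Definition separable_algebra : Prop :=
  semisimple_algebra /\
  forall B, simple_component B -> separable_subfield 'Z(B)%VS.

End SeparableAlgebra.

Section OrdersLattices.
Variables (O : idomainType) (K : fieldType) (iota : {rmorphism O -> K}).
Variable A : falgType K.

Definition K_in : set A := [set k%:A | k in [set: K]].
Definition O_in : set A := [set (iota a)%:A | a in [set: O]].

(* The localization O_p, as a subring of K embedded in A. *)
Definition Oloc_in (p : set O) : set A :=
  [set u | exists a s : O, ~ p s /\ u = (iota a / iota s)%:A].

Definition is_order (L : set A) : Prop :=
  [/\ L 1,
      forall x y, L x -> L y -> L (x * y),
      submodule O_in (L : set A^o),
      fin_gen O_in (L : set A^o) &
      sprod K_in (L : set A^o) = [set: A^o]].

Definition is_maximal_order (M : set A) : Prop :=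
  is_order M /\ forall N, is_order N -> M `<=` N -> N = M.

(* A lattice X is given inside the A-module V = K X. *)
Definition is_lattice (L : set A) (V : lmodType A) (X : set V) : Prop :=
  [/\ submodule L X,
      fin_gen O_in X,
      forall (a : O) x, X x -> a != 0 -> (iota a)%:A *: x = 0 -> x = 0 &
      sprod K_in X = [set: V]].

Definition localize (p : set O) (V : lmodType A) (X : set V) : set V :=
  sprod (Oloc_in p) X.

Definition locally_isomorphic (L : set A) (V W : lmodType A)
    (X : set V) (Y : set W) : Prop :=
  forall p : set O, is_maximal_ideal p ->
    exists g : V -> W,
      smod_iso (localize p (L : set A^o)) (localize p X) (localize p Y) g.

End OrdersLattices.

(* Main.v *)
Require Import Defs.
From HB Require Import structures.
From mathcomp Require Import all_boot all_algebra all_field.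
From mathcomp Require Import boolp classical_sets functions cardinality.

Set Implicit Arguments.
Unset Strict Implicit.
Unset Printing Implicit Defensive.

Import GRing.Theory.
Local Open Scope classical_set_scope.
Local Open Scope ring_scope.

(** The isomorphism [f] and its inverse extend to [A]-linear maps [F : V -> W]
    and [F'], and so do a local isomorphism [g] at [p] and its inverse, to [G]
    and [G'].  The automorphism [H = F G'] of [W] maps [Y_p] into itself, and its
    inverse [E = G F'] preserves the finitely generated module [M_p Y_p].
    By Cayley-Hamilton [E] is therefore integral over [O_p], so that [E] is a
    polynomial in [H] over [O_p] and preserves [Y_p] as well; hence
    [F' = G' E] maps [Y_p] into [X_p].  Thus for each [y] in [Y] the ideal of
    those [a] with [a y] in [f X] lies in no maximal ideal. *)

(** * Submodules, products [S X] and inverses of isomorphisms *)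

Section Submodules.
Variable R : pzRingType.
Implicit Types (V W : lmodType R) (S : set R).

Lemma submoduleN V S (X : set V) x : submodule S X -> X x -> X (- x).
Proof. by case=> X0 XB _ Xx; rewrite -sub0r; apply: XB. Qed.

Lemma submoduleD V S (X : set V) x y : submodule S X -> X x -> X y -> X (x + y).
Proof.
by move=> sX Xx Xy; rewrite -[y]opprK; case: (sX) => _ XB _; apply/XB/(submoduleN sX).
Qed.

Lemma submodule_sum V S (X : set V) (I : Type) (r : seq I) (P : pred I)
    (F : I -> V) :
  submodule S X -> (forall i, P i -> X (F i)) -> X (\sum_(i <- r | P i) F i).
Proof.
move=> sX XF; apply: (big_ind X) => //; first by case: sX.
by move=> x y; apply: submoduleD sX.
Qed.

Lemma submodule_sub V S S' (X : set V) :
  S `<=` S' -> submodule S' X -> submodule S X.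
Proof. by move=> SS' [X0 XB XZ]; split=> // s x /SS'; apply: XZ. Qed.

Lemma sprod_gen V S (X : set V) s x : S s -> X x -> sprod S X (s *: x).
Proof.
by move=> Ss Xx; exists 1, (fun=> s), (fun=> x); rewrite big_ord1.
Qed.

(** This serves as the induction principle for elements of [sprod S X]. *)
Lemma sprod_min V S (X U : set V) :
    U 0 -> (forall x y, U x -> U y -> U (x + y)) ->
    (forall s x, S s -> X x -> U (s *: x)) ->
  sprod S X `<=` U.
Proof.
move=> U0 UD UZ _ [n [s [x [Ss Xx ->]]]].
by apply: (big_ind U) => // i _; apply: UZ.
Qed.

Lemma sprod0 V S (X : set V) : sprod S X 0.
Proof.
by exists 0, (fun=> 0), (fun=> 0); split; [case | case | rewrite big_ord0].
Qed.

Lemma sprodD V S (X : set V) u v :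
  sprod S X u -> sprod S X v -> sprod S X (u + v).
Proof.
move=> [m [s [x [Ss Xx ->]]]] [n [t [y [St Xy ->]]]].
exists (m + n), (fun i => match fintype.split i with inl j => s j | inr j => t j end),
  (fun i => match fintype.split i with inl j => x j | inr j => y j end).
split; try by move=> i; case: fintype.split.
rewrite big_split_ord /=; congr (_ + _); apply: eq_bigr => i _.
  by rewrite (unsplitK (inl i)).
by rewrite (unsplitK (inr i)).
Qed.

(** Signs and scalars are absorbed by the coefficients in [S], so the conditions bear on [S] and [X]
    is an arbitrary set. *)
Lemma submodule_sprod V S S' (X : set V) :
    (forall s, S s -> S (- s)) -> (forall t s, S' t -> S s -> S (t * s)) ->
  submodule S' (sprod S X).
Proof.
move=> SN SM; split; first exact: sprod0.
  move=> u v Uu; move: v.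
  suff UN : sprod S X `<=` [set v | sprod S X (u - v)] by [].
  suff UN : sprod S X `<=` [set v | sprod S X (- v)].
    by move=> v /UN; apply: sprodD.
  apply: sprod_min => /= [|x y Ux Uy|s x Ss Xx].
  - by rewrite oppr0; apply: sprod0.
  - by rewrite opprD; apply: sprodD.
  - by rewrite -scaleNr; apply: sprod_gen => //; apply: SN.
move=> t v S't; move: v.
suff UZ : sprod S X `<=` [set v | sprod S X (t *: v)] by [].
apply: sprod_min => /= [|x y Ux Uy|s x Ss Xx].
- by rewrite scaler0; apply: sprod0.
- by rewrite scalerDr; apply: sprodD.
- by rewrite scalerA; apply: sprod_gen => //; apply: SM.
Qed.

Lemma smod_iso_inverse V W S (X : set V) (Y : set W) (f : V -> W) :
    submodule S X -> smod_iso S X Y f ->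
  exists f' : W -> V,
    [/\ smod_iso S Y X f', forall x, X x -> f' (f x) = x
      & forall y, Y y -> f (f' y) = y].
Proof.
move=> sX [[fXY finj fsurj] fD fZ].
have /choice[f' f'P] : forall y, exists x, Y y -> X x /\ f x = y.
  (* The value [0] off [Y] is a mere default that makes [f'] total. *)
  move=> y; have [Yy|nYy] := pselect (Y y); last by exists 0.
  by have [x Xx fxy] := fsurj _ Yy; exists x.
have f'X y : Y y -> X (f' y) by case/f'P.
have f'K y : Y y -> f (f' y) = y by case/f'P.
have inj x1 x2 : X x1 -> X x2 -> f x1 = f x2 -> x1 = x2.
  by move=> X1 X2; apply: finj; rewrite inE.
have fK x : X x -> f' (f x) = x.
  by move=> Xx; apply: inj; rewrite ?f'K //; [apply/f'X/fXY | apply: fXY].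
exists f'; split=> //; split.
- split=> //.
    by move=> y1 y2; rewrite !inE => Y1 Y2 e; rewrite -(f'K y1) // e f'K.
  by move=> x Xx; exists (f x); [apply: fXY | apply: fK].
- move=> y1 y2 Y1 Y2; rewrite -{1}(f'K _ Y1) -{1}(f'K _ Y2) -fD; try exact: f'X.
  by rewrite fK //; apply: (submoduleD sX); apply: f'X.
- move=> s y Ss Yy; rewrite -{1}(f'K _ Yy) -fZ //; try exact: f'X.
  by rewrite fK //; case: sX => _ _; apply=> //; apply: f'X.
Qed.

End Submodules.

(** * Prime and maximal ideals of a domain *)

Section Ideals.
Variable O : idomainType.

Lemma maximal_ideal_prime (p : set O) : is_maximal_ideal p -> is_prime_ideal p.
Proof.
move=> [pI p1 pmax]; split=> // x y pxy.
have [px|npx] := pselect (p x); [by left | right].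
(* This is the ideal [p + (x)]. If it contains [1], multiplying [1 = b + c x] by [y] puts [y] in
   [p]; otherwise maximality gives [I = p], so [x] lies in [p]. *)
pose I : set O := [set a | exists b c, p b /\ a = b + c * x].
have [p0 pB pZ] := pI.
have II : is_ideal I.
  split.
  - by exists 0, 0; rewrite mul0r addr0.
  - move=> _ _ [b [c [pb ->]]] [b' [c' [pb' ->]]].
    exists (b - b'), (c - c'); split; first exact: pB.
    by rewrite mulrBl opprD addrACA.
  - move=> s _ _ [b [c [pb ->]]]; exists (s * b), (s * c).
    by split; [apply: (pZ s b) | rewrite /GRing.scale /= mulrDr mulrA].
have pI' : p `<=` I by move=> b pb; exists b, 0; rewrite mul0r addr0.
have [[b [c [pb e1]]]|nI1] := pselect (I 1).
  have -> : y = y * b + c * (x * y) by rewrite -[LHS]mulr1 e1 mulrDr mulrCA [y * x]mulrC.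
  by apply: (submoduleD pI); [apply: (pZ y b) | apply: (pZ c (x * y))].
have Ip := pmax _ II nI1 pI'.
by case: npx; rewrite -Ip; exists 0, 1; rewrite mul1r add0r.
Qed.

(** Krull's theorem, by Zorn's lemma on the proper ideals containing [I]. *)
Lemma ideal_sub_maximal (I : set O) : is_ideal I -> ~ I 1 ->
  exists2 p, is_maximal_ideal p & I `<=` p.
Proof.
move=> II nI1.
pose P (J : set O) := J = set0 \/ [/\ is_ideal J, ~ J 1 & I `<=` J].
have /Zorn_bigcup[J [PJ Jmax]] :
    forall F, F `<=` P -> total_on F subset -> P (\bigcup_(J in F) J).
  move=> F FP Ftot.
  have [[J FJ J0]|nF] := pselect (exists2 J, F J & J !=set0); last first.
    left; rewrite -subset0 => x [J FJ Jx]; apply: nF.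
    by exists J => //; exists x.
  right.
  have FI L x : F L -> L x -> [/\ is_ideal L, ~ L 1 & I `<=` L].
    by move=> FL Lx; case: (FP _ FL) Lx => [->|].
  have [x0 Jx0] := J0; have [JI J1 IJ] := FI _ _ FJ Jx0.
  split.
  - split.
    + by exists J => //; case: JI.
    + move=> x y [L1 F1 Lx] [L2 F2 Ly].
      have [s12|s21] := Ftot _ _ F1 F2.
        exists L2 => //; have [[_ LB _] _ _] := FI _ _ F2 Ly.
        by apply: LB => //; apply: s12.
      exists L1 => //; have [[_ LB _] _ _] := FI _ _ F1 Lx.
      by apply: LB => //; apply: s21.
    + move=> s x _ [L FL Lx]; exists L => //.
      by have [[_ _ LZ] _ _] := FI _ _ FL Lx; apply: LZ.
  - by move=> [L FL L1]; have [_ /(_ L1)] := FI _ _ FL L1.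
  - by move=> x /IJ Jx; exists J.
have [JI J1 IJ] : [/\ is_ideal J, ~ J 1 & I `<=` J].
  case: PJ => // J0; exfalso; apply: (Jmax I); last by right; split.
  split; rewrite J0 => // /(_ 0); apply; by case: II.
exists J => //; split=> // L LI L1 JL.
apply: contrapT => LJ; apply: (Jmax L); last by right; split=> // x /IJ /JL.
by split=> // LsJ; apply: LJ; rewrite eqEsubset.
Qed.

Lemma zero_ideal_prime : is_prime_ideal [set 0 : O].
Proof.
split=> /=.
- split=> [//|x y -> ->|s x _ ->]; first exact: subr0.
  exact: mulr0.
- by apply/eqP; apply: oner_neq0.
- by move=> x y /eqP; rewrite mulf_eq0 => /orP[] /eqP; [left | right].
Qed.

End Ideals.

(** * Localization and clearing of denominators *)

Section FractionField.
Variables (O : idomainType) (K : fieldType) (iota : {rmorphism O -> K}).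
Hypothesis K_frac : is_fraction_field iota.
Variable A : falgType K.
Implicit Types (V W : lmodType A) (p : set O) (a b s : O).

Local Notation OA := (@O_in O K iota A).
Local Notation KA := (@K_in K A).

Definition Oscal : O -> A := in_alg A \o iota.
HB.instance Definition _ := GRing.RMorphism.on Oscal.

Lemma OscalE a : (iota a)%:A = Oscal a. Proof. by []. Qed.

Lemma O_in_Oscal a : OA (Oscal a). Proof. by exists a. Qed.

Lemma iota_neq0 a : a != 0 -> iota a != 0.
Proof. by rewrite -(rmorph0 iota) (inj_eq K_frac.1). Qed.

Lemma Oscal_comm a (x : A) : Oscal a * x = x * Oscal a.
Proof. by rewrite -OscalE mulr_algl mulr_algr. Qed.

Lemma OscalC V a (x : A) (v : V) : Oscal a *: (x *: v) = x *: (Oscal a *: v).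
Proof. by rewrite !scalerA Oscal_comm. Qed.

Lemma OscalM V a b (v : V) : Oscal (a * b) *: v = Oscal a *: (Oscal b *: v).
Proof. by rewrite scalerA rmorphM. Qed.

Lemma frac_Oscal a s : s != 0 -> Oscal s * (iota a / iota s)%:A = Oscal a.
Proof.
move=> s0; rewrite -OscalE mulr_algl scalerA mulrC divfK //; exact: iota_neq0.
Qed.

Lemma frac_OscalK V s (v : V) :
  s != 0 -> (iota 1 / iota s)%:A *: (Oscal s *: v) = v.
Proof.
by move=> s0; rewrite -OscalC scalerA frac_Oscal // rmorph1 scale1r.
Qed.

Lemma Oscal_inj V s (u v : V) : s != 0 -> Oscal s *: u = Oscal s *: v -> u = v.
Proof. by move=> s0 e; rewrite -(frac_OscalK u s0) e frac_OscalK. Qed.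

Lemma prime_nmem_neq0 p s : is_prime_ideal p -> ~ p s -> s != 0.
Proof. by case=> -[p0 _ _] _ _ nps; apply/eqP => s0; apply: nps; rewrite s0. Qed.

Lemma prime_nmemM p s t : is_prime_ideal p -> ~ p s -> ~ p t -> ~ p (s * t).
Proof. by case=> _ _ pM ns nt /pM[]. Qed.

Lemma O_submoduleZ V (X : set V) a x :
  submodule OA X -> X x -> X (Oscal a *: x).
Proof. by case=> _ _ XZ; apply/XZ/O_in_Oscal. Qed.

(** A finite sum has finitely many denominators, and their product stays outside the prime [p]; one
    denominator therefore suffices. *)
Lemma localizeP p V (X : set V) v :
    is_prime_ideal p -> submodule OA X ->
  localize iota p X v <-> exists2 s, ~ p s & X (Oscal s *: v).
Proof.
move=> pP sX; have [pI p1 pM] := pP; split; last first.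
  move=> [s ns Xsv]; have s0 := prime_nmem_neq0 pP ns.
  by rewrite -(frac_OscalK v s0); apply: sprod_gen => //; exists 1, s.
move: v; apply: sprod_min => /=.
- by exists 1 => //; rewrite scaler0; case: sX.
- move=> x y [s ns Xs] [t nt Xt]; exists (s * t); first exact: prime_nmemM.
  rewrite scalerDr; apply: (submoduleD sX).
    by rewrite mulrC OscalM; apply: O_submoduleZ.
  by rewrite OscalM; apply: O_submoduleZ.
- move=> _ x [a [s [ns ->]]] Xx; exists s => //.
  by rewrite scalerA frac_Oscal ?(prime_nmem_neq0 pP) //; apply: O_submoduleZ.
Qed.

Lemma sub_localize p V (X : set V) :
  is_prime_ideal p -> submodule OA X -> X `<=` localize iota p X.
Proof.
move=> pP sX x Xx; apply/localizeP => //; exists 1; first by case: pP.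
by rewrite rmorph1 scale1r.
Qed.

Lemma submodule_localize p V (X : set V) :
    is_prime_ideal p -> submodule OA X ->
  submodule OA (localize iota p X).
Proof.
move=> pP sX; apply: submodule_sprod.
  move=> _ [a [s [ns ->]]]; exists (- a), s; split=> //.
  by rewrite rmorphN mulNr scaleNr.
move=> _ _ [b _ <-] [a [s [ns ->]]]; exists (b * a), s; split=> //.
by rewrite mulr_algl scalerA rmorphM mulrA.
Qed.

Lemma submodule_localize_local p V (L : set A) (X : set V) :
    is_prime_ideal p -> submodule OA (L : set A^o) -> submodule OA X ->
    submodule L X ->
  submodule (localize iota p (L : set A^o)) (localize iota p X).
Proof.
move=> pP sL sXO [_ _ XZ]; have [X0 XB _] := submodule_localize pP sXO.
split=> // l x /(localizeP _ pP sL)[s ns Ls] /(localizeP _ pP sXO)[t nt Xt].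
apply/localizeP => //; exists (s * t); first exact: prime_nmemM.
by rewrite OscalM (OscalC t) scalerA; apply: XZ.
Qed.

(** First the denominator of [x] is cleared, then that of the image; their product works for
    [F x]. *)
Lemma localize_linear p V W (F : {linear V -> W}) (X : set V) (Y : set W) :
    (forall x, X x -> localize iota p Y (F x)) ->
    is_prime_ideal p -> submodule OA X ->
    submodule OA Y ->
  forall x, localize iota p X x -> localize iota p Y (F x).
Proof.
move=> XY pP sX sY x /(localizeP _ pP sX)[s ns Xsx].
have /(localizeP _ pP sY)[t nt Yt] := XY _ Xsx.
apply/localizeP => //; exists (t * s); first exact: prime_nmemM.
by rewrite OscalM -linearZ.
Qed.

Lemma common_denominator p V (X : set V) (I : finType) (v : I -> V) :
    is_prime_ideal p -> submodule OA X ->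
    (forall i, localize iota p X (v i)) ->
  exists2 s, ~ p s & forall i, X (Oscal s *: v i).
Proof.
move=> pP sX Xv.
have /choice[d dP] : forall i, exists s, ~ p s /\ X (Oscal s *: v i).
  by move=> i; have /localizeP[|//|s ns Xs] := Xv i; last exists s.
exists (\prod_i d i).
  apply: (big_ind (fun s => ~ p s)); first by case: pP.
    by move=> s t; apply: prime_nmemM.
  by move=> i _; case: (dP i).
move=> i; rewrite (bigD1 i) //= mulrC OscalM; apply: O_submoduleZ => //.
by case: (dP i).
Qed.

(** [K] is the localization of [O] at the zero prime, so clearing denominators over [K] becomes a
    case of [localizeP]. *)
Lemma K_in_Oloc : KA = Oloc_in iota [set 0].
Proof.
rewrite eqEsubset; split=> [_ [k _ <-]|_ [a [s [_ ->]]]]; last first.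
  by exists (iota a / iota s).
by have [a [b [/eqP b0 ->]]] := K_frac.2 k; exists a, b.
Qed.

Lemma clear_denominator V (X : set V) v :
    submodule OA X -> sprod KA X = [set: V] ->
  exists2 s, s != 0 & X (Oscal s *: v).
Proof.
move=> sX XK.
have /localizeP : localize iota [set 0] X v.
  by rewrite /localize -K_in_Oloc XK.
by case=> // [|s /eqP s0 Xs]; [exact: zero_ideal_prime | exists s].
Qed.

(** * Modules over an order and extension of maps to [A]-linear ones *)

Section Order.
Variable L : set A.
Hypothesis L_order : is_order iota L.

Lemma O_in_order : OA `<=` L.
Proof.
have [L1 _ [_ _ LZ] _ _] := L_order.
move=> _ [a _ <-]; rewrite -[_%:A]mulr1; apply: LZ => //; exact: O_in_Oscal.
Qed.

Lemma orderN x : L x -> L (- x).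
Proof. by case: L_order => _ _ sL _ _; apply: submoduleN sL. Qed.

Lemma order_submodule_O V (X : set V) :
  submodule L X -> submodule OA X.
Proof. by apply: submodule_sub; apply: O_in_order. Qed.

Lemma submodule_order_sprod V (X : set V) : submodule L (sprod L X).
Proof.
have [_ LM _ _ _] := L_order.
by apply: submodule_sprod => [s|t s]; [apply: orderN | apply: LM].
Qed.

Lemma sub_order_sprod V (X : set V) : X `<=` sprod L X.
Proof.
by move=> x Xx; rewrite -[x]scale1r; apply: sprod_gen => //; case: L_order.
Qed.

(* [L]-linearity on a full submodule suffices because [L] spans [A] over [K]. *)
Lemma linear_extension V W (X : set V) (f : V -> W) :
    submodule L X -> sprod KA X = [set: V] ->
    (forall x y, X x -> X y -> f (x + y) = f x + f y) ->
    (forall l x, L l -> X x -> f (l *: x) = l *: f x) ->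
  exists F : {linear V -> W}, forall x, X x -> F x = f x.
Proof.
move=> sX XK fD fZ; have sXO := order_submodule_O sX.
have [L1 LM sL _ LK] := L_order.
have fO a x : X x -> f (Oscal a *: x) = Oscal a *: f x.
  by move=> Xx; apply: fZ => //; apply/O_in_order/O_in_Oscal.
(* The value at [v] is built from one denominator [d], but it is recorded for every admissible [s],
   so that any convenient denominator can be used afterwards. *)
have /choice[F FP] : forall v, exists w, forall s, s != 0 ->
    X (Oscal s *: v) -> Oscal s *: w = f (Oscal s *: v).
  move=> v; have [d d0 Xd] := clear_denominator v sXO XK.
  exists ((iota 1 / iota d)%:A *: f (Oscal d *: v)) => s s0 Xs.
  apply: (@Oscal_inj _ d) => //.
  by rewrite !(OscalC d) frac_OscalK // -!fO // -!OscalM mulrC.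
have FL : linear F.
  move=> a u v.
  (* [c] brings the scalar [a] into [L], while [d] and [e] bring [u] and [v] into [X]; the product
     [c * d * e] serves all three vectors [a *: u], [v] and their sum. *)
  have [c c0 Lc] := clear_denominator (a : A^o) sL LK.
  have [d d0 Xd] := clear_denominator u sXO XK.
  have [e e0 Xe] := clear_denominator v sXO XK.
  have ea : Oscal (c * d * e) *: (a *: u)
      = Oscal e *: ((Oscal c * a) *: (Oscal d *: u)).
    by rewrite mulrC !OscalM (OscalC d) -scalerA.
  have Xca : X ((Oscal c * a) *: (Oscal d *: u)) by case: sX => _ _; apply.
  have Xa : X (Oscal (c * d * e) *: (a *: u)).
    by rewrite ea; apply: O_submoduleZ.
  have Xv : X (Oscal (c * d * e) *: v) by rewrite OscalM; apply: O_submoduleZ.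
  have n0 : c * d * e != 0 by rewrite !mulf_neq0.
  apply: (@Oscal_inj _ (c * d * e)) => //.
  rewrite FP // scalerDr; last exact: (submoduleD sX).
  rewrite fD // scalerDr -(FP v) //; congr (_ + _).
  rewrite ea fO // fZ // -(FP u) // -scalerA.
  by rewrite [c * d * e]mulrC !OscalM [Oscal d *: (a *: _)]OscalC.
pose Fl : {linear V -> W} := HB.pack F (GRing.isLinear.Build A V W *:%R F FL).
exists Fl => x Xx /=.
have := FP x 1 (oner_neq0 _); rewrite rmorph1 !scale1r; exact.
Qed.

End Order.

(** * Full and finitely generated submodules *)

Lemma linear_eq_on_full V W (F G : {linear V -> W}) (X : set V) :
    submodule OA X -> sprod KA X = [set: V] ->
    (forall x, X x -> F x = G x) -> F =1 G.
Proof.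
move=> sX XK FG v; have [s s0 Xs] := clear_denominator v sX XK.
by apply: (@Oscal_inj _ s) => //; rewrite -!linearZ; apply: FG.
Qed.

Lemma full_sub V (X X' : set V) : X `<=` X' ->
  sprod KA X = [set: V] -> sprod KA X' = [set: V].
Proof.
move=> XX' XK; rewrite -subTset -XK; apply: sprod_min; first exact: sprod0.
  by move=> x y; apply: sprodD.
by move=> s x Ks /XX'; apply: sprod_gen.
Qed.

(** The extra last entry is the default [0] of [nth]. It keeps the family nonempty, so that
    Cayley-Hamilton can be applied to matrices of size [n.+1]. *)
Lemma fin_gen_family V (X : set V) : fin_gen OA X ->
  exists (n : nat) (e : 'I_n.+1 -> V),
    (forall i, X (e i)) /\
    forall x, X x -> exists c : 'I_n.+1 -> O, x = \sum_i Oscal (c i) *: e i.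
Proof.
move=> [G /finite_seqP[r ->] ->]; exists (size r), (fun i => nth 0 r i); split.
  move=> i; have [lt|ge] := ltnP i (size r).
    by rewrite -[nth _ _ _]scale1r -(rmorph1 Oscal); apply: sprod_gen;
      [apply: O_in_Oscal | apply: mem_nth].
  by rewrite nth_default //; apply: sprod0.
apply: sprod_min => /=.
- by exists (fun=> 0); rewrite big1 // => i _; rewrite rmorph0 scale0r.
- move=> _ _ [c ->] [d ->]; exists (fun i => c i + d i).
  by rewrite -big_split; apply: eq_bigr => i _; rewrite rmorphD scalerDl.
- move=> _ x [a _ <-] xr.
  have lt : (index x r < (size r).+1)%N by rewrite ltnS index_size.
  exists (fun i => if i == Ordinal lt then a else 0).
  rewrite (bigD1 (Ordinal lt)) //= eqxx nth_index // big1 ?addr0 // => i /negPf ->.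
  by rewrite rmorph0 scale0r.
Qed.

(** Products of generators of [L] and of [Y] generate [L Y] over [O], because scalars from [O] are
    central in [A]. *)
Lemma fin_gen_sprod V (L : set A) (Y : set V) :
    is_order iota L -> fin_gen OA Y ->
  fin_gen OA (sprod L Y).
Proof.
move=> Lo [GY finY eY]; have [_ _ _ [GL finL eL] _] := Lo.
have one_in : OA 1 by rewrite -(rmorph1 Oscal); apply: O_in_Oscal.
exists [set (l : A) *: y | l in GL & y in GY]; first exact: finite_image2.
set U := sprod OA _.
have sU : submodule OA U.
  apply: submodule_sprod => [_ [a _ <-]|_ _ [a _ <-] [b _ <-]].
    by exists (- a) => //; rewrite rmorphN scaleNr.
  by exists (a * b) => //; rewrite !OscalE rmorphM.
rewrite eqEsubset; split; last first.
  have [_ _ LZ] := submodule_order_sprod Lo Y.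
  apply: sprod_min; first exact: sprod0.
    by move=> x y; apply: sprodD.
  move=> s _ Os [l Gl [y Gy <-]]; apply: LZ; first exact: O_in_order Lo _ Os.
  apply: sprod_gen.
    by rewrite eL -[l]mul1r; apply: (@sprod_gen _ A^o).
  by rewrite eY -[y]scale1r; apply: sprod_gen.
apply: sprod_min; first by case: sU.
  by move=> x y; apply: submoduleD sU.
(* The product [l *: y] is expanded first in [y] with [l] fixed, then in [l] with [y] a
   generator. *)
move=> l y; rewrite eL eY => Ll.
move: y; suff: sprod OA GY `<=` [set y | U (l *: y)] by [].
apply: sprod_min => /=; first by rewrite scaler0; case: sU.
  by move=> x y; rewrite scalerDr; apply: submoduleD sU.
move=> _ y [a _ <-] Gy; rewrite OscalE -OscalC; apply: O_submoduleZ => //.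
move: l Ll; suff: sprod OA (GL : set A^o) `<=` [set l : A^o | U (l *: y)].
  by [].
apply: sprod_min => /=; first by rewrite scale0r; case: sU.
  by move=> l m; rewrite scalerDl; apply: submoduleD sU.
move=> s l Os Gl; rewrite -scalerA; apply: sprod_gen => //.
by exists l => //; exists y.
Qed.

(** * Cayley-Hamilton and stability under an inverse *)

Lemma iter_linearZ V (E : {linear V -> V}) k (x : A) v :
  iter k E (x *: v) = x *: iter k E v.
Proof. by elim: k => //= k ->; rewrite linearZ. Qed.

Lemma iter_linear_sum V (E : {linear V -> V}) k (I : finType) (v : I -> V) :
  iter k E (\sum_i v i) = \sum_i iter k E (v i).
Proof. by elim: k => //= k ->; rewrite linear_sum. Qed.

(* Cayley-Hamilton for [s E], written without denominators. *)
Lemma char_poly_annihilates V (E : {linear V -> V}) n (e : 'I_n.+1 -> V) s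
    (C : 'M[O]_n.+1) :
    (forall i, Oscal s *: E (e i) = \sum_j Oscal (C i j) *: e j) ->
  forall c : 'I_n.+1 -> O,
  \sum_(k < n.+2) Oscal ((char_poly C)`_k * s ^+ k) *:
    iter k E (\sum_i Oscal (c i) *: e i) = 0.
Proof.
move=> EC c.
(* The powers of [C] describe the iterates of [s E] on the family [e], even if [e] is linearly
   dependent. *)
have powE k i :
    Oscal (s ^+ k) *: iter k E (e i) = \sum_j Oscal ((C ^+ k) i j) *: e j.
  elim: k => [|k IHk].
    rewrite !expr0 rmorph1 scale1r (bigD1 i) //= mxE eqxx rmorph1 scale1r.
    rewrite big1 ?addr0 // => j /negPf ij; rewrite mxE eq_sym ij.
    by rewrite rmorph0 scale0r.
  rewrite exprS OscalM /= -linearZ IHk linear_sum scaler_sumr /=.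
  under eq_bigr => j _ do rewrite linearZ OscalC EC scaler_sumr.
  rewrite exchange_big; apply: eq_bigr => l _ /=.
  rewrite exprSr mxE rmorph_sum scaler_suml; apply: eq_bigr => j _.
  by rewrite OscalM.
have chi0 i :
    \sum_(k < n.+2) Oscal ((char_poly C)`_k * s ^+ k) *: iter k E (e i) = 0.
  under eq_bigr => k _ do rewrite OscalM powE scaler_sumr.
  rewrite exchange_big big1 // => j _ /=.
  under eq_bigr => k _ do rewrite -OscalM.
  rewrite -scaler_suml -rmorph_sum.
  suff -> : \sum_(k < n.+2) (char_poly C)`_k * (C ^+ k) i j = 0.
    by rewrite rmorph0 scale0r.
  have := congr1 (fun B : 'M_n.+1 => B i j) (Cayley_Hamilton C).
  rewrite -{1}[char_poly C]coefK size_char_poly poly_def linear_sum summxE mxE.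
  move=> chiC; rewrite -[RHS]chiC; apply: eq_bigr => k _.
  by rewrite linearZ rmorphXn /= horner_mx_X mxE.
under eq_bigr => k _.
  rewrite iter_linear_sum scaler_sumr.
  under eq_bigr => i _ do rewrite iter_linearZ OscalC.
  over.
rewrite exchange_big big1 // => i _ /=.
by rewrite -scaler_sumr chi0 scaler0.
Qed.

(** Apply [H] to the power [n] to the characteristic relation of degree [n.+1]: the leading term
    becomes [s ^+ n.+1] times [E y], and the term of index [k <= n] becomes an [O]-multiple of the
    iterate of order [n - k] of [H] at [y], which lies in [Z]. *)
Lemma inverse_stable V (E H : {linear V -> V}) n (e : 'I_n.+1 -> V) s
    (C : 'M[O]_n.+1) (c : 'I_n.+1 -> O) (Z : set V) :
    (forall i, Oscal s *: E (e i) = \sum_j Oscal (C i j) *: e j) ->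
    cancel E H -> submodule OA Z -> (forall z, Z z -> Z (H z)) ->
  let y := \sum_i Oscal (c i) *: e i in
  Z y -> Z (Oscal (s ^+ n.+1) *: E y).
Proof.
move=> EC EK sZ HZ y Zy.
have HE k l : (k <= l)%N -> iter l H (iter k E y) = iter (l - k) H y.
  move=> /subnK {1}<-; rewrite iterD; congr (iter _ H _).
  by elim: k => //= k IHk; rewrite -iterS iterSr EK.
have := congr1 (iter n H) (char_poly_annihilates EC c).
(* The top term is split off; its coefficient is [1] since the characteristic polynomial is
   monic. *)
rewrite -/y iter_linear_sum big_ord_recr /=.
have -> : (char_poly C)`_n.+1 = 1.
  by have /monicP := char_poly_monic C; rewrite lead_coefE size_char_poly.
have -> : iter n H (0 : V) = 0 by elim: (n) => //= k ->; rewrite linear0.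
rewrite mul1r iter_linearZ.
have -> : iter n H (iter n.+1 E y) = E y.
  rewrite iterSr; elim: (n) => //= k IHk.
  by rewrite -iterS iterSr EK.
move/eqP; rewrite addrC addr_eq0 => /eqP ->.
apply: (submoduleN sZ); apply: (submodule_sum _ sZ) => k _.
rewrite iter_linearZ HE -1?ltnS //; apply: O_submoduleZ => //.
by elim: (n - k)%N => //= m; apply: HZ.
Qed.

End FractionField.

Theorem theorem3p1 (O : idomainType) (K : fieldType) (iota : {rmorphism O -> K})
    (O_dedekind : dedekind_domain O)
    (K_frac : is_fraction_field iota)
    (O_neq_K : range iota <> [set: K])
    (A : falgType K) (A_separable : separable_algebra A)
    (Lambda M : set A)
    (Lambda_order : is_order iota Lambda)
    (M_maximal : is_maximal_order iota M)
    (Lambda_sub_M : Lambda `<=` M)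
    (V W : lmodType A) (X : set V) (Y : set W)
    (X_lattice : is_lattice iota Lambda X)
    (Y_lattice : is_lattice iota Lambda Y)
    (XY_locally_iso : locally_isomorphic iota Lambda X Y)
    (f : V -> W) (f_iso : smod_iso M (sprod M X) (sprod M Y) f) :
  smod_iso Lambda X Y f <-> f @` X `<=` Y.
Proof.
split=> [[[fXY _ _] _ _] _ [x Xx <-]|fXY]; first exact: fXY.
have [M_order _] := M_maximal; have [sX _ _ XK] := X_lattice.
have [sY finY _ YK] := Y_lattice; have [_ _ sL _ _] := Lambda_order.
have sXO := order_submodule_O Lambda_order sX.
have sYO := order_submodule_O Lambda_order sY.
have sMX := submodule_order_sprod M_order X.
have sMY := submodule_order_sprod M_order Y.
have sMYO := order_submodule_O M_order sMY.
have XMX := @sub_order_sprod _ _ _ _ _ M_order _ X.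
have YMY := @sub_order_sprod _ _ _ _ _ M_order _ Y.
have [[fMXY finj _] fD fZ] := f_iso.
have [f' [[[f'MYX _ _] f'D f'Z] _ f'K]] := smod_iso_inverse sMX f_iso.
have [F Ff] := linear_extension K_frac M_order sMX (full_sub XMX XK) fD fZ.
have [F' F'f] := linear_extension K_frac M_order sMY (full_sub YMY YK) f'D f'Z.
have F'K : cancel F' F.
  have := @linear_eq_on_full _ _ _ K_frac _ _ _ (F \o F') idfun _ sYO YK.
  apply=> y /YMY MYy /=; rewrite F'f // Ff ?f'K //; exact: f'MYX.
have FX x : X x -> Y (F x).
  by move=> Xx; rewrite Ff; [apply: fXY; exists x | apply: XMX].
(* Injectivity and linearity of [f] on [X] are inherited from [M X]; only surjectivity onto [Y]
   remains. *)
suff YfX y : Y y -> exists2 x, X x & f x = y.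
  split.
  - split=> [x Xx|x x'|y /YfX[x Xx <-]]; [by apply: fXY; exists x | | by exists x].
    by rewrite !inE => /XMX MXx /XMX MXx'; apply: finj; rewrite inE.
  - by move=> x x' /XMX MXx /XMX; apply: fD.
  - by move=> l x /Lambda_sub_M Ml /XMX; apply: fZ.
move=> Yy.
(* The ideal of denominators of [F' y] relative to [X]; it contains [1] exactly when [F' y], the
   preimage of [y], lies in [X]. *)
pose I : set O := [set a | X (Oscal iota A a *: F' y)].
have II : is_ideal I.
  split.
  - by rewrite /I /= rmorph0 scale0r; case: sX.
  - by move=> a b Ia Ib; rewrite /I /= rmorphB scalerBl; case: sX => _ + _; apply.
  - by move=> a b _ Ib; rewrite /I /= [a *: b]/(a * b) OscalM; apply: O_submoduleZ.
suff I1 : I 1.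
  exists (F' y); first by move: I1; rewrite /I /= rmorph1 scale1r.
  by rewrite F'f ?f'K //; apply: YMY.
apply: contrapT => /(ideal_sub_maximal II)[p p_max Ip].
have pP := maximal_ideal_prime p_max.
have [g g_iso] := XY_locally_iso p p_max.
have XXp := sub_localize K_frac pP sXO.
have YYp := sub_localize K_frac pP sYO.
have sub_Lp := sub_localize K_frac pP sL.
have sYpO := submodule_localize pP sYO.
have sXp : submodule (localize iota p (Lambda : set A^o)) (localize iota p X).
  exact: submodule_localize_local.
have [[gXY _ _] gD gZ] := g_iso.
have [g' [[[g'YX _ _] g'D g'Z] g'K gK]] := smod_iso_inverse sXp g_iso.
have [G Gg] : exists G : {linear V -> W}, forall x, X x -> G x = g x.
  apply: (linear_extension K_frac Lambda_order sX XK).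
    by move=> x x' /XXp Xx /XXp; apply: gD.
  by move=> l x /sub_Lp Ll /XXp; apply: gZ.
have [G' G'g] : exists G' : {linear W -> V}, forall y, Y y -> G' y = g' y.
  apply: (linear_extension K_frac Lambda_order sY YK).
    by move=> x x' /YYp Yx /YYp; apply: g'D.
  by move=> l x /sub_Lp Ll /YYp; apply: g'Z.
have GX x : X x -> localize iota p Y (G x).
  by move=> Xx; rewrite Gg //; apply/gXY/XXp.
have G'Y z : Y z -> localize iota p X (G' z).
  by move=> Yz; rewrite G'g //; apply/g'YX/YYp.
have GK : cancel G G'.
  have := @linear_eq_on_full _ _ _ K_frac _ _ _ (G' \o G) idfun _ sXO XK.
  apply=> x Xx /=.
  (* [G'] is known to agree with [g'] only on [Y], whereas [G x] lies in its localization; scaling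
     by [s] brings it back into [Y]. *)
  have [s ns Ys] := (localizeP K_frac _ pP sYO).1 (GX _ Xx).
  apply: (@Oscal_inj _ _ _ K_frac _ _ s); first exact: prime_nmem_neq0 pP ns.
  have Xs := O_submoduleZ s sXO Xx.
  by rewrite -linearZ /= G'g // -linearZ Gg // g'K //; apply: XXp.
pose E : {linear W -> W} := G \o F'; pose H : {linear W -> W} := F \o G'.
have EK : cancel E H by move=> w; rewrite /E /H /= GK F'K.
(* [G'] sends the localization of [Y] to that of [X], and [F] sends it back by the assumed inclusion
   of [f X] in [Y]. *)
have HYp z : localize iota p Y z -> localize iota p Y (H z).
  move=> Yz; apply: (localize_linear K_frac _ pP sXO sYO).
    by move=> x Xx; apply/YYp/FX.
  exact: (localize_linear K_frac G'Y pP sYO sXO).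
(* [F'] maps [M Y] into [M X], so it is enough to treat [G (m *: x)]: by [A]-linearity [m] comes
   out, and the denominator of [G x] commutes with [m]. *)
have EMY z : sprod M Y z -> localize iota p (sprod M Y) (E z).
  move=> MYz; rewrite /E /= F'f //; move: (f' z) (f'MYX _ MYz) => {MYz}.
  have sMYp := submodule_localize pP sMYO.
  apply: sprod_min => /= [|x x'|m x Mm Xx].
  - by rewrite linear0; case: sMYp.
  - by rewrite linearD; apply: submoduleD sMYp.
  - have [s ns Ys] := (localizeP K_frac _ pP sYO).1 (GX _ Xx).
    apply/localizeP => //; exists s => //.
    by rewrite linearZ OscalC; apply: sprod_gen.
have [n [e [MYe genMY]]] := fin_gen_family (fin_gen_sprod M_order finY).
(* One [s] outside [p] clears the denominators of all [E (e i)], which yields a matrix [C] with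
   entries in [O] for [s E] on the generators of [M Y]. *)
have [s ns Ms] := common_denominator K_frac pP sMYO (fun i => EMY _ (MYe i)).
have /choice[C EC] := fun i => genMY _ (Ms i).
have [c ey] := genMY _ (YMY _ Yy).
have EC' i : Oscal iota A s *: E (e i) =
    \sum_j Oscal iota A ((\matrix_(i, j) C i j) i j) *: e j.
  by rewrite EC; apply: eq_bigr => j _; rewrite mxE.
(* The coordinates [c] of [y] refer to generators of [M Y], while the stable set is the localization
   of [Y], to which [y] belongs. *)
have := inverse_stable (c := c) EC' EK sYpO HYp; rewrite -ey => /(_ (YYp _ Yy)).
(* As [G' E = F'], applying [G'] puts [s ^+ n.+1] times [F' y] in the localization of [X]. Clearing
   a last denominator [t] gives [t * s ^+ n.+1] in [I], hence in [p], although neither [t] nor [s]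
   is in the prime [p]. *)
move=> /(localize_linear K_frac G'Y pP sYO sXO).
rewrite linearZ /E /= GK => /(localizeP K_frac _ pP sXO)[t nt].
rewrite -OscalM => /Ip; apply: prime_nmemM => //.
elim: (n.+1) => [|k IHk]; first by case: pP.
by rewrite exprS; apply: prime_nmemM.
Qed.
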